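(* Let $A, B, X$ be complex $n\times n$ matrices and let $f_1,f_2,g_1,g_2:[0,\infty)\to[0,\infty)$ be continuous functions such that $f_1(t)f_2(t)=t$ and $g_1(t)g_2(t)=t$ for all $t\ge 0$. Then $$\|AXB^*\|^2\leq\|f_1(A^*A)\,X\,g_1(B^*B)\|\;\|f_2(A^*A)\,X\,g_2(B^*B)\|.$$
   Context: $\|\cdot\|$ denotes the operator (spectral) norm, i.e. $\|A\|=s_1(A)$ is the largest singular value of $A$. For a Hermitian matrix $H$ and a function $f$ continuous on the spectrum of $H$, $f(H)$ is defined by the continuous functional calculus. *)

(* Defs.v *)
From HB Require Import structures.
From mathcomp Require Import all_boot all_order all_algebra.
From mathcomp Require Export sesquilinear spectral.
From mathcomp Require Import all_classical all_reals all_analysis.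
From mathcomp Require Export complex.

Set Implicit Arguments.
Unset Strict Implicit.
Unset Printing Implicit Defensive.

Import Order.TTheory GRing.Theory Num.Theory.
Import numFieldNormedType.Exports.

Local Open Scope classical_set_scope.
Local Open Scope ring_scope.
Local Open Scope sesquilinear_scope.
Local Open Scope complex_scope.

(* The functions [0, oo) -> [0, oo) are represented by functions R -> R whose
   values at negative reals are unconstrained; [nneg_continuous f] says that
   f restricts to a continuous map from [0, oo) to itself. *)
Definition nneg_continuous (R : realType) (f : R -> R) : Prop :=
  {within `[0, +oo[, continuous f} /\ forall t, 0 <= t -> 0 <= f t.

(* If H = P^-1 diag(l_1, ..., l_n) P with P unitary, then f(H) is
   P^-1 diag(f(l_1), ..., f(l_n)) P; the eigenvalues l_i are real when H is
   Hermitian, so [complex.Re] loses nothing. Only meant for Hermitian H. *)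
Definition herm_fun (R : realType) (n : nat) (f : R -> R) (H : 'M[R[i]]_n) :
    'M[R[i]]_n :=
  invmx (spectralmx H)
  *m diag_mx (map_mx (fun l : R[i] => (f (complex.Re l))%:C) (spectral_diag H))
  *m spectralmx H.

(* In no particular order, and counted with multiplicity. *)
Definition singular_values (R : realType) (m n : nat) (A : 'M[R[i]]_(m, n)) :
    'rV[R]_n :=
  \row_j Num.sqrt (complex.Re (spectral_diag (A ^t* *m A) 0 j)).

(* The default value 0 of the maximum only matters for n = 0. *)
Definition opnorm (R : realType) (m n : nat) (A : 'M[R[i]]_(m, n)) : R :=
  \big[Num.max/0]_j singular_values A 0 j.

(* [herm_fun f H] does not depend on the diagonalization chosen for H. *)
Lemma herm_fun_diag (R : realType) (n : nat) (f : R -> R) (U : 'M[R[i]]_n)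
    (d : 'rV[R]_n) : U \is unitarymx ->
  herm_fun f (invmx U *m diag_mx (map_mx (real_complex R) d) *m U)
  = invmx U *m diag_mx (map_mx (fun x => (f x)%:C) d) *m U.
Proof.
move=> Uu; set D := diag_mx _; set H := _ *m U.
have Un : U \in unitmx by apply: unitarymx_unit.
have Hn : H \is normalmx.
  apply/normalmxP.
  have UE : invmx U = U ^t* by rewrite invmx_unitary.
  have DE : D ^t* = D.
    apply/matrixP => i j; rewrite !mxE eq_sym.
    have [->|] := eqVneq i j; last by rewrite !mulr0n rmorph0.
    by rewrite !mulr1n; exact: conjc_real.
  have HE : H ^t* = H.
    have UK : (U ^t*) ^t* = U by apply/matrixP => i j; rewrite !mxE conjCK.
    by rewrite /H UE !trmx_mul !map_mxM DE UK mulmxA.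
  by rewrite HE.
have /orthomx_spectralP HE := Hn.
rewrite /herm_fun; set P := spectralmx H in HE *; set s := spectral_diag H in HE *.
have Pn : P \in unitmx by apply: spectral_unit.
pose W := P *m invmx U.
have WD : W *m D = diag_mx s *m W.
  have : P *m H *m invmx U = W *m D.
    by rewrite /H /W !mulmxA mulmxK.
  by move=> <-; rewrite [in LHS]HE !mulmxA mulmxV// mul1mx.
have WF : W *m diag_mx (map_mx (fun x => (f x)%:C) d)
   = diag_mx (map_mx (fun l : R[i] => (f (complex.Re l))%:C) s) *m W.
  move: W WD => W WD; apply/matrixP => i j; move/matrixP: WD => /(_ i j).
  rewrite !mul_mx_diag !mul_diag_mx !mxE.
  have [->|W0] := eqVneq (W i j) 0; first by rewrite !mulr0 !mul0r.
  by rewrite mulrC => /(mulIf W0) <-; rewrite mulrC.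
have PE : P = W *m U by rewrite /W mulmxKV.
have WE : invmx P *m W = invmx U by rewrite /W mulmxA mulVmx// mul1mx.
by rewrite [X in _ *m X = _]PE mulmxA -(mulmxA _ _ W) -WF mulmxA WE.
Qed.

(* Main.v *)
Require Import Defs.
From HB Require Import structures.
From mathcomp Require Import all_boot all_order all_algebra.
From mathcomp Require Import all_classical all_reals all_analysis.

Set Implicit Arguments.
Unset Strict Implicit.
Unset Printing Implicit Defensive.

Import Order.TTheory GRing.Theory Num.Theory.
Import numFieldNormedType.Exports.
Local Open Scope ring_scope.
Local Open Scope sesquilinear_scope.

(* The square of the norm of M := A X B^* is an eigenvalue of M^* M, which is
   B X^* (A^* A) X B^*.  As P Q and Q P have the same nonzero eigenvalues, one
   factor can be moved cyclically: B first and then, after factoring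
   A^* A = f2 f1 and B^* B = g1 g2, also g2.  So the square of the norm of M is
   an eigenvalue of (f2 X g2)^* (f1 X g1), hence is at most the product of the
   norms of f2 X g2 and f1 X g1. *)

(** A row eigenvector [v] of [M *m N] yields the eigenvector [v *m M] of [N *m M]; it is nonzero, as
    [v *m M = 0] would force [a *: v = 0]. *)
Lemma eigenvalue_mulmxC (F : fieldType) (n : nat) (M N : 'M[F]_n) (a : F) :
  a != 0 -> eigenvalue (M *m N) a -> eigenvalue (N *m M) a.
Proof.
move=> a0 /eigenvalueP[v vE v0]; apply/eigenvalueP; exists (v *m M).
  by rewrite scalemxAl -vE !mulmxA.
apply: contra_neq v0 => vM0; move/eqP: vE.
by rewrite mulmxA vM0 mul0mx eq_sym scaler_eq0 (negPf a0) => /eqP.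
Qed.

Lemma trmxC_mul (C : numClosedFieldType) (m n p : nat) (M : 'M[C]_(m, n))
    (N : 'M[C]_(n, p)) : (M *m N) ^t* = N ^t* *m M ^t*.
Proof. by rewrite trmx_mul map_mxM. Qed.

Lemma gram_hermsymmx (C : numClosedFieldType) (m n : nat) (A : 'M[C]_(m, n)) :
  A ^t* *m A \is hermsymmx.
Proof.
by apply/is_hermitianmxP; rewrite expr0 scale1r trmxC_mul trmxCK.
Qed.

Lemma dotmx_mulmx (C : numClosedFieldType) (m n : nat) (u : 'rV[C]_m)
    (v : 'rV[C]_n) (M : 'M[C]_(m, n)) :
  dotmx (u *m M) v = dotmx u (v *m M ^t*).
Proof. by rewrite !dotmxE trmxC_mul trmxCK mulmxA. Qed.

Lemma gram_spectralE (C : numClosedFieldType) (m n : nat) (A : 'M[C]_(m, n)) :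
  let G := A ^t* *m A in
  G = (spectralmx G) ^t* *m diag_mx (spectral_diag G) *m spectralmx G.
Proof.
move=> G; rewrite -invmx_unitary ?spectral_unitarymx//.
exact/orthomx_spectralP/hermitian_normalmx/gram_hermsymmx.
Qed.

Lemma row_gram_spectral (C : numClosedFieldType) (m n : nat)
    (A : 'M[C]_(m, n)) (j : 'I_n) :
  let G := A ^t* *m A in
  row j (spectralmx G) *m G = spectral_diag G 0 j *: row j (spectralmx G).
Proof.
move=> G; have := congr1 (mulmx (spectralmx G)) (gram_spectralE A).
rewrite -row_mul -/G !mulmxA (unitarymxP _) ?spectral_unitarymx// mul1mx => ->.
by apply/rowP => k; rewrite mul_diag_mx !mxE.
Qed.

Lemma dotmx_row_spectralmx (C : numClosedFieldType) (n : nat) (H : 'M[C]_n)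
    (j : 'I_n) : dotmx (row j (spectralmx H)) (row j (spectralmx H)) = 1.
Proof. by rewrite (row_unitarymxP _) ?spectral_unitarymx// eqxx. Qed.

(** For a unit row eigenvector u of G, the eigenvalue is u G u^* = |u A^*|^2. *)
Lemma gram_spectral_diag_ge0 (C : numClosedFieldType) (m n : nat)
    (A : 'M[C]_(m, n)) (j : 'I_n) : 0 <= spectral_diag (A ^t* *m A) 0 j.
Proof.
set G := A ^t* *m A; set u := row j (spectralmx G).
have <- : dotmx (u *m A ^t*) (u *m A ^t*) = spectral_diag G 0 j.
  rewrite -dotmx_mulmx -mulmxA.
  by rewrite row_gram_spectral linearZl /= dotmx_row_spectralmx mulr1.
exact: dnorm_ge0.
Qed.

Lemma gram_spectral_diag_eigenvalue (C : numClosedFieldType) (m n : nat)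
    (A : 'M[C]_(m, n)) (j : 'I_n) :
  eigenvalue (A ^t* *m A) (spectral_diag (A ^t* *m A) 0 j).
Proof.
apply/eigenvalueP; exists (row j (spectralmx (A ^t* *m A))).
  exact: row_gram_spectral.
by rewrite -(dnorm_eq0 (@dotmx C n)) /= dotmx_row_spectralmx oner_eq0.
Qed.

(** The eigenvalues are nonnegative in [R[i]], hence real, so neither the real part nor the square
    root in [singular_values] loses anything. *)
Lemma singular_values_sqr (R : realType) (m n : nat) (A : 'M[R[i]]_(m, n))
    (j : 'I_n) :
  ((singular_values A 0 j ^+ 2)%:C)%C = spectral_diag (A ^t* *m A) 0 j.
Proof.
have s_ge0 := gram_spectral_diag_ge0 A j.
have sE := RRe_real (ger0_real s_ge0).
by rewrite mxE sqr_sqrtr ?sE// -lecR sE.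
Qed.

Lemma opnorm_ge0 (R : realType) (m n : nat) (A : 'M[R[i]]_(m, n)) :
  0 <= opnorm A.
Proof. exact: bigmax_ge_id. Qed.

Lemma opnorm_sqr_eigenvalue (R : realType) (m n : nat) (A : 'M[R[i]]_(m, n)) :
  opnorm A != 0 -> eigenvalue (A ^t* *m A) ((opnorm A ^+ 2)%:C)%C.
Proof.
move=> A0; have [j _ ->] : {j | true & opnorm A = singular_values A 0 j}.
  (* For n = 0 the norm is the default 0, which [A0] excludes. Otherwise the maximum is attained,
     since no singular value is below that default. *)
  have [j _|n0] := pickP 'I_n; last by rewrite /opnorm big_pred0 ?eqxx in A0.
  by apply: (eq_bigmax j) => // i _; rewrite mxE sqrtr_ge0.
by rewrite singular_values_sqr; exact: gram_spectral_diag_eigenvalue.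
Qed.

(** In coordinates y along an orthonormal eigenbasis of A^* A, the left side is the sum of the s_j
    |y_j|^2, and each s_j is at most the squared norm. *)
Lemma dotmx_le_opnorm (R : realType) (m n : nat) (A : 'M[R[i]]_(m, n))
    (w : 'rV[R[i]]_n) :
  dotmx (w *m A ^t*) (w *m A ^t*) <= ((opnorm A ^+ 2)%:C)%C * dotmx w w.
Proof.
rewrite -dotmx_mulmx -mulmxA gram_spectralE.
set G := A ^t* *m A; set P := spectralmx G; set s := spectral_diag G.
have Pu : P \is unitarymx := spectral_unitarymx G.
rewrite !mulmxA dotmx_mulmx; set y := w *m P ^t*.
have -> : dotmx w w = dotmx y y.
  by rewrite /y dotmx_mulmx trmxCK mulmxKtV.
move: y => y.
rewrite !dotmxE mul_mx_diag !mxE mulr_sumr ler_sum// => j _.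
rewrite !mxE [y 0 j * s 0 j]mulrC -mulrA ler_wpM2r ?mul_conjC_ge0//.
rewrite /s -singular_values_sqr lecR lerXn2r ?nnegrE ?opnorm_ge0//.
  by rewrite mxE sqrtr_ge0.
exact: le_bigmax.
Qed.

(** An eigenvector w satisfies a |w|^2 = <w M^*, w N^*>, to which Cauchy-Schwarz applies. *)
Lemma eigenvalue_le_opnorm (R : realType) (m n : nat) (M N : 'M[R[i]]_(m, n))
    (a : R) :
  0 <= a -> eigenvalue (M ^t* *m N) (a%:C)%C -> a <= opnorm M * opnorm N.
Proof.
move=> a0 /eigenvalueP[w wE w0].
have ww_gt0 : 0 < dotmx w w by rewrite dnorm_gt0.
(* Both sides are squared and multiplied by |w|^4, to match the squared form of [CauchySchwarz]. *)
rewrite -(@ler_pXn2r _ 2)// ?nnegrE ?mulr_ge0 ?opnorm_ge0// -lecR.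
rewrite -(ler_pM2r (exprn_gt0 2 ww_gt0)).
have -> : ((a ^+ 2)%:C)%C * dotmx w w ^+ 2
    = `|dotmx (w *m M ^t*) (w *m N ^t*)| ^+ 2.
  rewrite -dotmx_mulmx -mulmxA wE linearZl /= normrM exprMn.
  by rewrite !ger0_norm ?dnorm_ge0 ?ler0c// rmorphXn.
apply: le_trans (CauchySchwarz _ _ _) _.
rewrite exprMn rmorphM expr2 mulrACA.
by rewrite ler_pM ?dnorm_ge0 ?dotmx_le_opnorm.
Qed.

Lemma mulmx_conj_unitmx (F : fieldType) (n : nat) (P D E : 'M[F]_n) :
  P \in unitmx ->
  (invmx P *m D *m P) *m (invmx P *m E *m P) = invmx P *m (D *m E) *m P.
Proof. by move=> Pu; rewrite !mulmxA (mulmxK Pu). Qed.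

Lemma trmxC_conj_unitarymx (C : numClosedFieldType) (n : nat)
    (P D : 'M[C]_n) : P \is unitarymx ->
  (invmx P *m D *m P) ^t* = invmx P *m D ^t* *m P.
Proof.
by move=> Pu; rewrite invmx_unitary// !trmxC_mul trmxCK mulmxA.
Qed.

Lemma trmxC_herm_fun (R : realType) (n : nat) (f : R -> R) (H : 'M[R[i]]_n) :
  (herm_fun f H) ^t* = herm_fun f H.
Proof.
set d := map_mx (fun l : R[i] => ((f (complex.Re l))%:C)%C) (spectral_diag H).
have dC : (diag_mx d) ^t* = diag_mx d.
  apply/matrixP => i j; rewrite !mxE eq_sym.
  have [->|_] := eqVneq i j; last by rewrite !mulr0n rmorph0.
  by rewrite !mulr1n conj_Creal// complex_real.
have := trmxC_conj_unitarymx (diag_mx d) (spectral_unitarymx H).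
by rewrite dC.
Qed.

(** Both factors are diagonal in the same eigenbasis, so it suffices that f(s_j) g(s_j) = s_j. *)
Lemma herm_fun_mul_gram (R : realType) (m n : nat) (f g : R -> R)
    (A : 'M[R[i]]_(m, n)) :
  (forall t, 0 <= t -> f t * g t = t) ->
  herm_fun f (A ^t* *m A) *m herm_fun g (A ^t* *m A) = A ^t* *m A.
Proof.
move=> fg; set G := A ^t* *m A.
apply: etrans (mulmx_conj_unitmx _ _ (spectral_unit G)) _.
rewrite mulmx_diag [RHS]gram_spectralE -/G.
rewrite -(invmx_unitary (spectral_unitarymx G)).
set d := (X in diag_mx X).
suff -> : d = spectral_diag G by [].
apply/rowP => j.
(* As the square of a singular value, s_j is a nonnegative real, so [fg] applies. *)
by rewrite !mxE -rmorphM/= -singular_values_sqr fg// sqr_ge0.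
Qed.

Theorem theorem2p1 (R : realType) (n : nat) (A B X : 'M[R[i]]_n)
    (f1 f2 g1 g2 : R -> R)
    (hf1 : nneg_continuous f1) (hf2 : nneg_continuous f2)
    (hg1 : nneg_continuous g1) (hg2 : nneg_continuous g2)
    (hf : forall t : R, 0 <= t -> f1 t * f2 t = t)
    (hg : forall t : R, 0 <= t -> g1 t * g2 t = t) :
  opnorm (A *m X *m B ^t*) ^+ 2 <=
    opnorm (herm_fun f1 (A ^t* *m A) *m X *m herm_fun g1 (B ^t* *m B)) *
    opnorm (herm_fun f2 (A ^t* *m A) *m X *m herm_fun g2 (B ^t* *m B)).
Proof.
(* Cyclic moves are available for nonzero eigenvalues only. *)
have [->|N0] := eqVneq (opnorm (A *m X *m B ^t*)) 0.
  by rewrite expr0n mulr_ge0 ?opnorm_ge0.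
have := opnorm_sqr_eigenvalue N0; rewrite !trmxC_mul trmxCK.
move: (opnorm (A *m X *m _)) N0 => a N0 aE.
have a0 : ((a ^+ 2)%:C)%C != 0 :> R[i].
  by rewrite (fmorph_eq0 (real_complex R)) expf_neq0.
have hf21 t : 0 <= t -> f2 t * f1 t = t by rewrite mulrC; exact: hf.
have := herm_fun_mul_gram A hf21; have := herm_fun_mul_gram B hg.
have := trmxC_herm_fun f2 (A ^t* *m A).
have := trmxC_herm_fun g2 (B ^t* *m B).
(* [herm_fun] has to be made opaque: it unfolds to a product of matrices, on
   which the rewriting below would act. *)
move: (herm_fun f1 _) (herm_fun f2 _) (herm_fun g1 _) (herm_fun g2 _).
move=> F1 F2 G1 G2 G2C F2C GE FE.
rewrite mulrC; apply: eigenvalue_le_opnorm; first exact: sqr_ge0.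
rewrite !trmxC_mul F2C G2C -!mulmxA.
(* [G2] moves from the front to the back, where it meets [G1]. *)
apply: (eigenvalue_mulmxC a0).
rewrite -!mulmxA GE (mulmxA F2) FE !mulmxA.
(* The last factor [B] of B^* B moves to the front. *)
apply: (eigenvalue_mulmxC a0).
by rewrite !mulmxA in aE *.
Qed.
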